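(* If $\tilde w=t^{2k\alpha_1+k\alpha_2}s_1s_2\tau$ with $k\in\mathbb{N}_+$, then $$f_{\tilde w,\mathbb{O}}=\begin{cases}(v-v^{-1})^2,&\mathbb{O}=\mathbb{O}_{\lambda,\tau}\text{ with }\lambda\in\bigsqcup_{j=2}^kE_{(2j-1)\alpha_1+j\alpha_2,\tau},\\ v-v^{-1},&\mathbb{O}=\mathbb{O}_{i,\tau}\text{ with }2-2k\leq i\leq k,\\ 1,&\mathbb{O}=\mathbb{O}_{id,\tau},\\ 0,&\text{otherwise.}\end{cases}$$
   Context: $W=\langle s_1,s_2\rangle$ is the finite Weyl group of type $A_2$; $\alpha_1,\alpha_2$ are the simple roots, identified with the simple coroots ($\langle\alpha_i,\alpha_i\rangle=2$, $\langle\alpha_1,\alpha_2\rangle=-1$); $Q=\mathbb{Z}\alpha_1\oplus\mathbb{Z}\alpha_2$; $P$ is the coweight lattice, $P_+$ its dominant elements; $\widetilde W=P\rtimes W$ with translations $t^\lambda$. $W_a=Q\rtimes W$ is the Coxeter group generated by $s_0=t^{\alpha_1+\alpha_2}s_1s_2s_1$, $s_1$, $s_2$; $\widetilde W=W_a\rtimes\langle\tau\rangle$ with $\tau^3=1$, $\tau s_0\tau^{-1}=s_1$, $\tau s_1\tau^{-1}=s_2$, $\tau s_2\tau^{-1}=s_0$, i.e. $\tau=t^{(2\alpha_1+\alpha_2)/3}s_1s_2$; $\ell(w\tau^j)=\ell(w)$ for $w\in W_a$. $\mathbb{N}_+$ is the set of positive integers. Class polynomials: $\widetilde H$ is the algebra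 over $\mathbb{Z}[v,v^{-1}]$ with basis $T_{\tilde w}$ ($\tilde w\in\widetilde W$), $T_{\tilde x}T_{\tilde y}=T_{\tilde x\tilde y}$ if $\ell(\tilde x)+\ell(\tilde y)=\ell(\tilde x\tilde y)$, and $(T_s-v)(T_s+v^{-1})=0$ for $s\in\{s_0,s_1,s_2\}$. $[\widetilde H,\widetilde H]$ is the submodule spanned by commutators. For a conjugacy class $\mathbb{O}$ of $\widetilde W$, $T_{\mathbb{O}}$ is the image in $\widetilde H/[\widetilde H,\widetilde H]$ of $T_{w}$ for any minimal length $w\in\mathbb{O}$; by He–Nie this is well defined and the $T_{\mathbb{O}}$ form a basis. The class polynomials $f_{\tilde w,\mathbb{O}}$ are the unique coefficients with $T_{\tilde w}\equiv\sum_{\mathbb{O}}f_{\tilde w,\mathbb{O}}T_{\mathbb{O}}\bmod[\widetilde H,\widetilde H]$. Conjugacy classes of $\widetilde W$ in $W_a\tau$: $\mathbb{O}_{id,\tau}=\{t^{m\alpha_1+n\alpha_2}\tau,\ t^{m\alpha_1+n\alpha_2}s_1s_2\tau\mid m,n\in\mathbb{Z}\}$; for $\lambda\in P_+\cap Q$ not of the form $2m\alpha_1+m\alpha_2$ ($m\geq0$), $\mathbb{O}_{\lambda,\tau}$ is the class of $t^\lambda s_2s_1\tau$; for $i\in\mathbb{Z}$, $\mathbb{O}_{i,\tau}=\{t^{k\alpha_1+i\alpha_2}s_1s_2s_1\tau,\ t^{(k+i-1)\alpha_1+k\alpha_2}s_2\tau,\ t^{(1-i)\alpha_1+k\alpha_2}s_1\tau\mid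 k\in\mathbb{Z}\}$. $E_{m\alpha_1+n\alpha_2,\tau}=\{k\alpha_1+n\alpha_2\mid\lfloor\frac n2\rfloor+1\leq k\leq m-1\}$. *)

(* Defs.v *)
From HB Require Import structures.
From mathcomp Require Import all_boot all_order all_algebra all_fingroup.
From mathcomp Require Import fraction.
From mathcomp Require Import ring zify.
From mathcomp Require Import boolp classical_sets functions cardinality fsbigop.

Set Implicit Arguments.
Unset Strict Implicit.
Unset Printing Implicit Defensive.

Import Order.TTheory GRing.Theory Num.Theory.

Local Open Scope classical_set_scope.
Local Open Scope ring_scope.

(* Z[v, v^-1] is the subring of Frac(Z[v]) of the fractions that become
   polynomials after multiplication by a power of v; v is ['X]. *)

Notation ratfun := {fraction {poly int}}.

Definition fv : ratfun := tofrac ('X : {poly int}).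

Definition is_laurent : {pred ratfun} :=
  fun x => `[< exists (n : nat) (p : {poly int}), x * fv ^+ n = tofrac p >].

Lemma is_laurentP x :
  reflect (exists (n : nat) (p : {poly int}), x * fv ^+ n = tofrac p)
          (x \in is_laurent).
Proof. exact: asboolP. Qed.

Lemma fv_neq0 : fv != 0.
Proof. by rewrite tofrac_eq0 polyX_eq0. Qed.

Lemma is_laurent_subring : subring_closed is_laurent.
Proof.
split.
- by apply/is_laurentP; exists 0, 1; rewrite mul1r expr0 tofrac1.
- move=> x y /is_laurentP[n [p xp]] /is_laurentP[m [q yq]].
  apply/is_laurentP; exists (n + m)%N, (p * 'X^m - q * 'X^n).
  rewrite tofracB !tofracM !tofracXn -/fv -xp -yq exprD; ring.
- move=> x y /is_laurentP[n [p xp]] /is_laurentP[m [q yq]].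
  apply/is_laurentP; exists (n + m)%N, (p * q).
  by rewrite tofracM -xp -yq exprD; ring.
Qed.

HB.instance Definition _ :=
  GRing.isSubringClosed.Build ratfun is_laurent is_laurent_subring.

Record laurent : predArgType :=
  Laurent { laurent_val :> ratfun; _ : laurent_val \in is_laurent }.

HB.instance Definition _ := [isSub for laurent_val].
HB.instance Definition _ := [Choice of laurent by <:].
HB.instance Definition _ := [SubChoice_isSubComNzRing of laurent by <:].

Lemma fv_laurent : fv \in is_laurent.
Proof. by apply/is_laurentP; exists 0, 'X; rewrite mulr1. Qed.

Lemma fvV_laurent : fv^-1 \in is_laurent.
Proof.
by apply/is_laurentP; exists 1%N, 1; rewrite tofrac1 mulVf // fv_neq0.
Qed.

Definition v : laurent := Laurent fv_laurent.
Definition vinv : laurent := Laurent fvV_laurent.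

Lemma v_vinv : v * vinv = 1.
Proof. by apply: val_inj; rewrite /= mulfV // fv_neq0. Qed.

(* [lam : coweight] has coordinates (<lam, alpha1>, <lam, alpha2>), i.e. it
   is written in the basis of fundamental coweights. *)
Definition coweight : Type := (int * int)%type.
HB.instance Definition _ := GRing.Zmodule.on coweight.

Definition alpha1 : coweight := (2, -1).
Definition alpha2 : coweight := (-1, 2).

Notation I3_0 := (@Ordinal 3 0 isT).
Notation I3_1 := (@Ordinal 3 1 isT).
Notation I3_2 := (@Ordinal 3 2 isT).

(* P is Z^3 / Z(1,1,1), on which W = S_3 permutes coordinates: [lift3] picks
   the representative whose last coordinate is 0, [proj3] goes back.  Since
   (w * u) i = u (w i) in ['S_3], [x |-> x \o w] is a left action. *)
Definition lift3 (lam : coweight) (i : 'I_3) : int :=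
  nth 0 [:: lam.1 + lam.2; lam.2; 0] i.

Definition proj3 (x : 'I_3 -> int) : coweight := (x I3_0 - x I3_1, x I3_1 - x I3_2).

Definition wact (w : 'S_3) (lam : coweight) : coweight :=
  proj3 (lift3 lam \o w).

Lemma coweightD (a b c d : int) :
  ((a, b) : coweight) + ((c, d) : coweight) = (a + c, b + d).
Proof. by []. Qed.

Lemma ord3P (P : 'I_3 -> Prop) : P I3_0 -> P I3_1 -> P I3_2 -> forall i, P i.
Proof.
move=> P0 P1 P2 [[|[|[|//]]] lt_i3].
- by rewrite (_ : Ordinal _ = I3_0) //; apply: val_inj.
- by rewrite (_ : Ordinal _ = I3_1) //; apply: val_inj.
- by rewrite (_ : Ordinal _ = I3_2) //; apply: val_inj.
Qed.

Lemma wact1 lam : wact 1%g lam = lam.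
Proof.
by case: lam => a b; rewrite /wact /proj3 /= !perm1 /lift3 /= subr0 addrK.
Qed.

Lemma lift3_proj3 x i : lift3 (proj3 x) i = x i - x I3_2.
Proof. by move: i; apply: ord3P; rewrite /lift3 /=; ring. Qed.

Lemma wactM w u lam : wact (w * u)%g lam = wact w (wact u lam).
Proof.
rewrite {2}/wact {1}/wact /proj3 /= !permM /wact !lift3_proj3 /=.
by congr pair; ring.
Qed.

Lemma wactD w lam mu : wact w (lam + mu) = wact w lam + wact w mu.
Proof.
have liftD i : lift3 (lam + mu) i = lift3 lam i + lift3 mu i.
  case: lam mu => [a b] [c d]; rewrite coweightD.
  by move: i; apply: ord3P; rewrite /lift3 /= ?addr0 //; ring.
by rewrite /wact /proj3 /= !liftD coweightD; congr pair; ring.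
Qed.

Lemma wact0 w : wact w 0 = 0.
Proof. by apply: (@addrI _ (wact w 0)); rewrite -wactD !addr0. Qed.

Lemma wactN w lam : wact w (- lam) = - wact w lam.
Proof. by apply: (@addrI _ (wact w lam)); rewrite -wactD !subrr wact0. Qed.

(* [Ext lam w] is t^lam w. *)
Record extW : Type := Ext { ext_trans : coweight; ext_lin : 'S_3 }.

Definition extW_pair (x : extW) := (ext_trans x, ext_lin x).
Definition pair_extW (p : coweight * 'S_3) := Ext p.1 p.2.
Lemma extW_pairK : cancel extW_pair pair_extW.
Proof. by case. Qed.

HB.instance Definition _ := Choice.copy extW (can_type extW_pairK).

Definition extW_mul (x y : extW) : extW :=
  Ext (ext_trans x + wact (ext_lin x) (ext_trans y)) (ext_lin x * ext_lin y)%g.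
Definition extW_one : extW := Ext 0 1%g.
Definition extW_inv (x : extW) : extW :=
  Ext (wact (ext_lin x)^-1%g (- ext_trans x)) (ext_lin x)^-1%g.

Lemma extW_mulA : associative extW_mul.
Proof.
by move=> x y z; rewrite /extW_mul /= wactD wactM addrA mulgA.
Qed.

Lemma extW_mul1 : left_id extW_one extW_mul.
Proof. by case=> lam w; rewrite /extW_mul /= wact1 add0r mul1g. Qed.

Lemma extW_1mul : right_id extW_one extW_mul.
Proof. by case=> lam w; rewrite /extW_mul /= wact0 addr0 mulg1. Qed.

Lemma extW_mulV : left_inverse extW_one extW_inv extW_mul.
Proof.
by case=> lam w; rewrite /extW_mul /= -wactD addNr wact0 mulVg.
Qed.

Lemma extW_Vmul : right_inverse extW_one extW_inv extW_mul.
Proof.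
by case=> lam w; rewrite /extW_mul /= -wactM mulgV wact1 subrr.
Qed.

HB.instance Definition _ := isGroup.Build extW
  extW_mulA extW_mul1 extW_1mul extW_mulV extW_Vmul.

Definition tr (lam : coweight) : extW := Ext lam 1%g.
Definition s1 : extW := Ext 0 (tperm I3_0 I3_1).
Definition s2 : extW := Ext 0 (tperm I3_1 I3_2).
Definition s0 : extW := (tr (alpha1 + alpha2) * s1 * s2 * s1)%g.

(* (2 alpha1 + alpha2) / 3 is the first fundamental coweight. *)
Definition omega1 : coweight := (1, 0).
Definition tau : extW := (tr omega1 * s1 * s2)%g.

Lemma omega1E : omega1 *+ 3 = alpha1 *+ 2 + alpha2.
Proof. by []. Qed.

Lemma coweight_mulz (a b m : int) : ((a, b) : coweight) *~ m = (a * m, b * m).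
Proof.
rewrite -!mulrzz [LHS]surjective_pairing; congr pair.
- exact: (raddfMz (@fst int int)).
- exact: (raddfMz (@snd int int)).
Qed.

Lemma wact_s1 lam : wact (ext_lin s1) lam = lam - alpha1 *~ lam.1.
Proof.
case: lam => a b; rewrite /alpha1 coweight_mulz /wact /proj3 /=.
rewrite tpermL tpermR tpermD // /lift3 /=.
rewrite (_ : (a, b) - _ = (a - 2 * a, b - -1 * a)) //.
by congr pair; ring.
Qed.

Lemma wact_s2 lam : wact (ext_lin s2) lam = lam - alpha2 *~ lam.2.
Proof.
case: lam => a b; rewrite /alpha2 coweight_mulz /wact /proj3 /=.
rewrite tpermL tpermR tpermD // /lift3 /=.
rewrite (_ : (a, b) - _ = (a - -1 * b, b - 2 * b)) //.
by congr pair; ring.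
Qed.

Definition srefl (i : 'I_3) : extW := nth 1%g [:: s0; s1; s2] i.

Lemma extW_eq (x y : extW) :
  ext_trans x = ext_trans y -> ext_lin x =1 ext_lin y -> x = y.
Proof.
by case: x y => [lam w] [mu u] /= -> eq_wu; congr Ext; apply/permP.
Qed.

Lemma wactE w (a b : int) : wact w (a, b) =
  (lift3 (a, b) (w I3_0) - lift3 (a, b) (w I3_1),
   lift3 (a, b) (w I3_1) - lift3 (a, b) (w I3_2)).
Proof. by []. Qed.

Lemma s0E : s0 = Ext (1, 1) (tperm I3_0 I3_2).
Proof.
apply: extW_eq; last by apply: ord3P; rewrite /= !permM !perm1 !permE.
by rewrite /= !wact0 !addr0.
Qed.

Lemma tauE : tau = Ext (1, 0) (tperm I3_0 I3_1 * tperm I3_1 I3_2)%g.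
Proof.
apply: extW_eq; last by apply: ord3P; rewrite /= !permM !perm1 !permE.
by rewrite /= !wact0 !addr0.
Qed.

Lemma extW_mulE lam w mu u :
  (Ext lam w * Ext mu u = Ext (lam + wact w mu) (w * u))%g.
Proof. by []. Qed.

Ltac extW_calc :=
  rewrite ?s0E ?tauE /s1 /s2 !extW_mulE; apply: extW_eq;
  [ rewrite /= ?wactM ?wactE /lift3 ?permM ?permE /= ?wactE /lift3 ?permM ?permE /= //
  | by apply: ord3P; rewrite /= ?permM ?perm1 ?permE ].

Lemma tau_s0 : (tau * s0 = s1 * tau)%g.
Proof. extW_calc. 
Qed.
Lemma tau_s1 : (tau * s1 = s2 * tau)%g.
Proof. extW_calc. Qed.
Lemma tau_s2 : (tau * s2 = s0 * tau)%g.
Proof. extW_calc. Qed.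

Lemma tau2E :
  (tau * tau)%g = Ext (0, 1) (tperm I3_1 I3_2 * tperm I3_0 I3_1)%g.
Proof. extW_calc. Qed.

Lemma tauX3 : (tau ^+ 3 = 1)%g.
Proof. by rewrite !expgS expg0 mulg1 tau2E; extW_calc. Qed.

Definition word_prod (r : seq 'I_3) : extW := (\prod_(i <- r) srefl i)%g.

(* W_a is the Coxeter group on s_0, s_1, s_2 and extW = W_a ><| <tau>, so that
   the length of x is the least size of a word r with x = (prod of r) tau^j. *)
Definition has_word (x : extW) (n : nat) : Prop :=
  exists (r : seq 'I_3) (j : nat), size r = n /\ x = (word_prod r * tau ^+ j)%g.

Lemma has_word_srefl i x : (exists n, has_word x n) ->
  exists n, has_word (srefl i * x)%g n.
Proof.
move=> [n [r [j [_ ->]]]]; exists (size (i :: r)), (i :: r), j; split=> //.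
by rewrite /word_prod big_cons mulgA.
Qed.

Lemma has_word_tau x : (exists n, has_word x n) ->
  exists n, has_word (tau * x)%g n.
Proof.
have tau_srefl (i : 'I_3) : (tau * srefl i)%g = (srefl (ordS i) * tau)%g.
  by move: i; apply: ord3P; [exact: tau_s0 | exact: tau_s1 | exact: tau_s2].
have tau_word r : (tau * word_prod r = word_prod (map (@ordS 3) r) * tau)%g.
  rewrite /word_prod big_map; elim: r => [|i r IHr].
    by rewrite !big_nil mulg1 mul1g.
  by rewrite !big_cons mulgA tau_srefl -[LHS]mulgA IHr [LHS]mulgA.
move=> [n [r [j [_ ->]]]]; exists (size (map (@ordS 3) r)), (map (@ordS 3) r), j.+1.
by split=> //; rewrite expgS [LHS]mulgA tau_word -[LHS]mulgA.
Qed.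

Lemma wordable x : exists n, has_word x n.
Proof.
pose G (y : extW) := forall x, (exists n, has_word x n) ->
  exists n, has_word (y * x)%g n.
have G1 : G 1%g by move=> y; rewrite mul1g.
have GM y z : G y -> G z -> G (y * z)%g.
  by move=> Gy Gz u /Gz /Gy; rewrite mulgA.

have G0 : G s0 by exact: (@has_word_srefl I3_0).
have Gs1 : G s1 by exact: (@has_word_srefl I3_1).
have Gs2 : G s2 by exact: (@has_word_srefl I3_2).
have Gtau : G tau by exact: has_word_tau.
have Gtr1 : G (tr (1, 0)).
  rewrite (_ : tr _ = tau * s2 * s1)%g; last by rewrite /tr; extW_calc.
  exact: (GM _ _ (GM _ _ Gtau Gs2) Gs1).
have Gtr1N : G (tr (-1, 0)).
  rewrite (_ : tr _ = s1 * s2 * (tau * tau))%g; last first.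
    by rewrite tau2E /tr; extW_calc.
  exact: (GM _ _ (GM _ _ Gs1 Gs2) (GM _ _ Gtau Gtau)).
have Gtr2 : G (tr (0, 1)).
  rewrite (_ : tr _ = tau * tau * s1 * s2)%g; last first.
    by rewrite tau2E /tr; extW_calc.
  exact: (GM _ _ (GM _ _ (GM _ _ Gtau Gtau) Gs1) Gs2).
have Gtr2N : G (tr (0, -1)).
  rewrite (_ : tr _ = s2 * s1 * tau)%g; last by rewrite /tr; extW_calc.
  exact: (GM _ _ (GM _ _ Gs2 Gs1) Gtau).
have trD lam mu : tr (lam + mu) = (tr lam * tr mu)%g.
  by rewrite /tr extW_mulE wact1 mulg1.
have Gtr0n (n : nat) : G (tr (0, n%:Z)) /\ G (tr (0, - n%:Z)).
  elim: n => [|n [IH1 IH2]]; first by split=> y; rewrite mul1g.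
  split; [rewrite (_ : (0, _) = (0, 1) + (0, n%:Z) :> coweight) ?trD
         | rewrite (_ : (0, _) = (0, -1) + (0, - n%:Z) :> coweight) ?trD].
  - exact: GM.
  - by rewrite coweightD; congr pair; lia.
  - exact: GM.
  - by rewrite coweightD; congr pair; lia.
have Gtr0 (b : int) : G (tr (0, b)).
  by case: (intP b) => [|n|n]; [case: (Gtr0n 0) | case: (Gtr0n n.+1)
                               | case: (Gtr0n n.+1)].
have Gtrn (n : nat) (b : int) : G (tr (n%:Z, b)) /\ G (tr (- n%:Z, b)).
  elim: n => [|n [IH1 IH2]]; first by rewrite oppr0; split.
  split; [rewrite (_ : (_, b) = (1, 0) + (n%:Z, b) :> coweight) ?trD
         | rewrite (_ : (_, b) = (-1, 0) + (- n%:Z, b) :> coweight) ?trD].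
  - exact: GM.
  - by rewrite coweightD; congr pair; lia.
  - exact: GM.
  - by rewrite coweightD; congr pair; lia.
have Gtr lam : G (tr lam).
  case: lam => a b; case: (intP a) => [|n|n]; first exact: Gtr0.
  - by case: (Gtrn n.+1 b).
  - by case: (Gtrn n.+1 b).
pose L w : extW := Ext 0 w.
have LM w u : L (w * u)%g = (L w * L u)%g by rewrite /L extW_mulE wact0 addr0.
have GL w : G (L w).
  have [ts -> _] := prod_tpermP w; elim: ts => [|[i j] ts IHts].
    by rewrite big_nil.
  rewrite big_cons LM; apply: (GM) => //=.
  have Gs (i' j' : 'I_3) : (i' < j')%N -> G (L (tperm i' j')).
    have Gs02 : G (L (tperm I3_0 I3_2)).
      rewrite (_ : L _ = s1 * s2 * s1)%g; last by rewrite /L; extW_calc.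
      exact: (GM _ _ (GM _ _ Gs1 Gs2) Gs1).
    by move: i' j'; do 2![apply: ord3P].
  case: (ltngtP i j) => [/Gs//||/val_inj->]; last by rewrite tperm1.
  by rewrite tpermC => /Gs.
have <- : (tr (ext_trans x) * L (ext_lin x) * 1 = x)%g.
  by rewrite mulg1 /tr extW_mulE wact1 addr0 mul1g; case: (x).
apply: (GM _ _ (Gtr _) (GL _)); exists 0, [::], 0; split=> //.
by rewrite /word_prod big_nil mul1g.
Qed.

Lemma wordableb x : exists n, `[< has_word x n >].
Proof. by have [n xn] := wordable x; exists n; apply/asboolP. Qed.

Definition ell (x : extW) : nat := ex_minn (wordableb x).

Definition conj_class (x : extW) : set extW :=
  [set (y * x * y^-1)%g | y in [set: extW]].

Definition conj_classes : set (set extW) := range conj_class.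

Definition min_length (O : set extW) (x : extW) : Prop :=
  O x /\ forall y, O y -> (ell x <= ell y)%N.

Definition min_reps (m : set extW -> extW) : Prop :=
  forall O, conj_classes O -> min_length O (m O).

(* [c] is finitely supported on D and x = \sum_(i in D) c i *: e i modulo N. *)
Definition expansion (V : lmodType laurent) (N : set V) (I : choiceType)
    (D : set I) (e : I -> V) (x : V) (c : I -> laurent) : Prop :=
  finite_set (D `&` [set i | c i != 0]) /\
  N (x - \sum_(i \in D) c i *: e i).

Definition basis_mod (V : lmodType laurent) (N : set V) (I : choiceType)
    (D : set I) (e : I -> V) : Prop :=
  (forall x, exists c, expansion N D e x c) /\
  (forall x c c', expansion N D e x c -> expansion N D e x c' ->
     forall i, D i -> c i = c' i).

Record is_hecke (H : algType laurent) (T : extW -> H) : Prop := IsHecke {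
  hecke_basis : basis_mod [set 0] [set: extW] T;
  hecke_mul : forall x y,
    (ell x + ell y)%N = ell (x * y)%g -> T x * T y = T (x * y)%g;
  hecke_quad : forall i : 'I_3,
    (T (srefl i) - v%:A) * (T (srefl i) + vinv%:A) = 0 }.

(* [H, H] as a submodule: scalars are redundant since a[x, y] = [a x, y]. *)
Definition commutators (H : algType laurent) : set H :=
  [set h | exists r : seq (laurent * (H * H)),
     h = \sum_(p <- r) p.1 *: (p.2.1 * p.2.2 - p.2.2 * p.2.1)].
Arguments commutators : clear implicits.

(* The theorem of He and Nie: T_O is well defined in H / [H, H], and the T_O
   form a basis of it. *)
Definition he_nie (H : algType laurent) (T : extW -> H) : Prop :=
  (forall O x y, conj_classes O -> min_length O x -> min_length O y ->
     commutators H (T x - T y)) /\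
  (forall m, min_reps m ->
     basis_mod (commutators H) conj_classes (T \o m)).

(* [f O], for O ranging over the conjugacy classes, are coefficients of T_x on
   the T_O modulo [H, H], T_O being computed with any minimal length element
   of O.  The values of f outside [conj_classes] are irrelevant. *)
Definition class_polynomials (H : algType laurent) (T : extW -> H) (x : extW)
    (f : set extW -> laurent) : Prop :=
  forall m, min_reps m ->
    expansion (commutators H) conj_classes (T \o m) (T x) f.

Definition tQ (m n : int) : extW := tr (alpha1 *~ m + alpha2 *~ n).

Definition O_id_tau : set extW :=
  [set x | exists m n : int,
     x = (tQ m n * tau)%g \/ x = (tQ m n * s1 * s2 * tau)%g].

Definition O_lam_tau (lam : coweight) : set extW :=
  conj_class (tr lam * s2 * s1 * tau)%g.

Definition O_int_tau (i : int) : set extW :=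
  [set x | exists k : int,
     [\/ x = (tQ k i * s1 * s2 * s1 * tau)%g,
         x = (tQ (k + i - 1) k * s2 * tau)%g |
         x = (tQ (1 - i) k * s1 * tau)%g]].

Definition E_tau (m n : int) : set coweight :=
  [set lam | exists k : int,
     [/\ (n %/ 2)%Z + 1 <= k, k <= m - 1 & lam = alpha1 *~ k + alpha2 *~ n]].

(* Main.v *)
(* A Deligne-Lusztig style reduction modulo [H, H]: T_x does not change when x is
   conjugated by tau, or by a simple reflection s preserving its length, whereas
   T_x = T_{sxs} + (v - v^-1) T_{sx} if l(sxs) < l(x).

   Write (a, b) for a omega1 + b omega2.  The element of the theorem is
   w_k = t^(3k-1, 1) s2 s1.  Three reductions lead from w_k to w_{k-1} (two of them
   from w_1 to tau) and split off three (resp. two) elements with a reflection as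
   linear part.  Up to conjugation by tau they are t^(a, b) s1 with (a, b) equal to
   (0, 2 - 3k), (3k - 2, 0) and (1, 3 - 3k); they lie in O_{2-2k}, O_k, O_{3-2k}.
   The elements with 0 <= a <= 2 have minimal length, but t^(3k-2, 0) s1 slides
   along t^(a, b) s1 -> t^(a-2, b+1) s1 while a > 2, and each slide splits off the
   translation t^(a-2, b+1).  As t^lam s2 s1 tau = t^(lam - omega2), these are the
   classes O_lam for lam in E_{(2k-1) alpha1 + k alpha2}. *)
Require Import Defs.
From mathcomp Require Import all_boot all_order all_algebra all_fingroup.
From mathcomp Require Import boolp classical_sets functions cardinality fsbigop.
From mathcomp Require Import ring zify.

Set Implicit Arguments.
Unset Strict Implicit.
Unset Printing Implicit Defensive.

Import Order.TTheory GRing.Theory Num.Theory.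

Local Open Scope classical_set_scope.
Local Open Scope ring_scope.

(** * Lengths in the extended affine Weyl group *)

Notation p1 := (tperm I3_0 I3_1).
Notation p2 := (tperm I3_1 I3_2).
Notation p12 := (p1 * p2)%g.
Notation p21 := (p2 * p1)%g.
Notation p0 := (tperm I3_0 I3_2).

Lemma S3_ind (P : 'S_3 -> Prop) :
  P 1%g -> P p1 -> P p2 -> P p12 -> P p21 -> P p0 -> forall w, P w.
Proof.
move=> P_1 P_p1 P_p2 P_12 P_21 P_0 w.
have inj01 : w I3_0 != w I3_1 by rewrite (inj_eq perm_inj).
have inj02 : w I3_0 != w I3_2 by rewrite (inj_eq perm_inj).
have inj12 : w I3_1 != w I3_2 by rewrite (inj_eq perm_inj).
have wE (u : 'S_3) : w I3_0 = u I3_0 -> w I3_1 = u I3_1 -> w I3_2 = u I3_2 ->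
    P u -> P w.
  by move=> *; rewrite (_ : w = u) //; apply/permP; exact: ord3P.
move: inj01 inj02 inj12 wE.
move: (w I3_0) (w I3_1) (w I3_2).
(* Injectivity leaves 6 of the 27 value triples. Products apply their left factor first, so (1, 2,
   0) is [p21] and (2, 0, 1) is [p12]. *)
apply: ord3P; apply: ord3P; apply: ord3P => // _ _ _ wE;
  [ apply: (wE _ _ _ _ P_1) | apply: (wE _ _ _ _ P_p2) | apply: (wE _ _ _ _ P_p1)
  | apply: (wE _ _ _ _ P_21) | apply: (wE _ _ _ _ P_12) | apply: (wE _ _ _ _ P_0) ];
  by rewrite ?permM ?perm1 ?permE //= ?permE.
Qed.

Lemma coweightN (a b : int) : - ((a, b) : coweight) = (- a, - b).
Proof. by []. Qed.

Lemma wactS (a b : int) :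
  (wact 1%g (a, b) = (a, b)) * (wact p1 (a, b) = (- a, a + b))
  * (wact p2 (a, b) = (a + b, - b)) * (wact p12 (a, b) = (- a - b, a))
  * (wact p21 (a, b) = (b, - a - b)) * (wact p0 (a, b) = (- b, - a)).
Proof.
split; last by rewrite wactE /lift3 !permE /=; congr pair; lia.
split; last by rewrite wactE /lift3 !permM !permE /=; congr pair; lia.
split; last by rewrite wactE /lift3 !permM !permE /=; congr pair; lia.
split; last by rewrite wactE /lift3 !permE /=; congr pair; lia.
by split; [exact: wact1 | rewrite wactE /lift3 !permE /=; congr pair; lia].
Qed.

Lemma perm3M :
  (p12 * p12 = p21)%g * (p21 * p21 = p12)%g
  * (p12 * p21 = 1)%g * (p21 * p12 = 1)%g
  * (p1 * p12 = p2)%g * (p1 * p21 = p0)%g * (p2 * p12 = p0)%g * (p2 * p21 = p1)%g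
  * (p12 * p0 = p2)%g * (p21 * p0 = p1)%g * (p0 * p12 = p1)%g * (p0 * p21 = p2)%g
  * (p12 * p1 = p0)%g * (p12 * p2 = p1)%g * (p21 * p1 = p2)%g * (p21 * p2 = p0)%g
  * (p1 * p1 = 1)%g * (p2 * p2 = 1)%g * (p0 * p0 = 1)%g
  * (p1 * p0 = p21)%g * (p2 * p0 = p12)%g * (p0 * p1 = p12)%g * (p0 * p2 = p21)%g.
Proof. by do !split; apply/permP; apply: ord3P; rewrite ?permM ?perm1 ?permE. Qed.

Lemma perm3V :
  (p12^-1 = p21)%g * (p21^-1 = p12)%g
  * (p1^-1 = p1)%g * (p2^-1 = p2)%g * (p0^-1 = p0)%g * (1^-1 = 1 :> 'S_3)%g.
Proof. by rewrite !invMg !tpermV invg1. Qed.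

Lemma extW_invE lam w : ((Ext lam w)^-1 = Ext (- wact w^-1 lam) w^-1)%g.
Proof. by rewrite -wactN. Qed.

Lemma s1E : s1 = Ext (0, 0) p1. Proof. by []. Qed.
Lemma s2E : s2 = Ext (0, 0) p2. Proof. by []. Qed.
Lemma tau_E : tau = Ext (1, 0) p12. Proof. exact: tauE. Qed.
Lemma oneE : (1 : extW)%g = Ext (0, 0) 1. Proof. by []. Qed.

Lemma tQE m n : tQ m n = Ext (2 * m - n, 2 * n - m) 1%g.
Proof.
rewrite /tQ /alpha1 /alpha2 !coweight_mulz coweightD /tr.
by congr (Ext (_, _) _); lia.
Qed.

Ltac extW_norm :=
  rewrite ?s0E ?s1E ?s2E ?tau_E ?oneE ?tQE ?extW_invE ?extW_mulE ?perm3V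
          ?mul1g ?mulg1 ?perm3M ?wactS ?coweightN ?coweightD ?perm3M ?extW_mulE ?perm3M
          ?wactS ?coweightN ?coweightD ?perm3M.
Ltac extW_solve :=
  repeat progress extW_norm; congr (Ext (_, _) _); rewrite /=; lia.

(* The Iwahori-Matsumoto formula: [w j < w i] for i < j is the condition that w^-1 maps
   the positive root e_i - e_j to a negative one. *)
Definition len (x : extW) : nat :=
  let: (a, b) := ext_trans x in let w := ext_lin x in
  (`|(a - (w I3_1 < w I3_0)%N%:Z)%R| + `|(b - (w I3_2 < w I3_1)%N%:Z)%R|
  + `|(a + b - (w I3_2 < w I3_0)%N%:Z)%R|)%N.

Lemma lenS (a b : int) :
  (len (Ext (a, b) 1%g) = (`|a| + `|b| + `|(a + b)%R|)%N)
  * (len (Ext (a, b) p1) = (`|(a - 1)%R| + `|b| + `|(a + b)%R|)%N)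
  * (len (Ext (a, b) p2) = (`|a| + `|(b - 1)%R| + `|(a + b)%R|)%N)
  * (len (Ext (a, b) p12) = (`|(a - 1)%R| + `|b| + `|(a + b - 1)%R|)%N)
  * (len (Ext (a, b) p21) = (`|a| + `|(b - 1)%R| + `|(a + b - 1)%R|)%N)
  * (len (Ext (a, b) p0) = (`|(a - 1)%R| + `|(b - 1)%R| + `|(a + b - 1)%R|)%N).
Proof.
by do !split; rewrite /len /= ?permM ?perm1 ?permE /= ?permE /= ?subr0.
Qed.

Lemma extW_ind (P : extW -> Prop) : (forall a b w, P (Ext (a, b) w)) ->
  forall x, P x.
Proof. by move=> Pabw [[a b] w]. Qed.

Lemma len_mul_tau x : len (x * tau)%g = len x.
Proof.
move: x; apply: extW_ind => a b; apply: S3_ind;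
  repeat progress extW_norm; rewrite !lenS; lia.
Qed.

Lemma sreflK i x : (srefl i * (srefl i * x) = x)%g.
Proof.
rewrite mulgA (_ : srefl i * srefl i = 1)%g ?mul1g //.
by move: (i); apply: ord3P; rewrite /srefl /=; extW_solve.
Qed.

Lemma len_srefl i x : (len (srefl i * x)%g <= (len x).+1)%N.
Proof.
move: i; apply: ord3P; move: x; apply: extW_ind => a b; apply: S3_ind;
  rewrite /srefl /=;
  repeat progress extW_norm; rewrite !lenS; lia.
Qed.

Lemma len_descent x : (exists i, (len (srefl i * x)%g < len x)%N) \/
  exists j, x = (tau ^+ j)%g.
Proof.
have [E0 E1 E2] : [/\ Ext (0, 0) 1 = (tau ^+ 0)%g, Ext (1, 0) p12 = (tau ^+ 1)%g
    & Ext (0, 1) p21 = (tau ^+ 2)%g].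
  by split; [| rewrite expg1 tau_E | rewrite expgS expg1; extW_solve].
have down : [|| (len (s0 * x)%g < len x)%N, (len (s1 * x)%g < len x)%N
      | (len (s2 * x)%g < len x)%N] ->
    (exists i, (len (srefl i * x)%g < len x)%N) \/ exists j, x = (tau ^+ j)%g.
  by case/or3P=> H; left; [exists I3_0 | exists I3_1 | exists I3_2].
move: x down; apply: extW_ind => a b.
(* For each even linear part exactly one translation part gives length zero, a power of [tau]; with
   an odd linear part the length is odd, hence positive. *)
have z0 : (a = 0 /\ b = 0) \/ (a != 0 \/ b != 0) by lia.
have z1 : (a = 1 /\ b = 0) \/ (a != 1 \/ b != 0) by lia.
have z2 : (a = 0 /\ b = 1) \/ (a != 0 \/ b != 1) by lia.
apply: S3_ind => down;
  [ case: z0 => [[-> ->]|z]; first by right; exists 0%N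
  | | | case: z1 => [[-> ->]|z]; first by right; exists 1%N
  | case: z2 => [[-> ->]|z]; first by right; exists 2%N
  | ]; by apply: down; repeat progress extW_norm; rewrite !lenS; lia.
Qed.

Lemma len_tauX j : len (tau ^+ j)%g = 0%N.
Proof.
by elim: j => [|j IHj]; [rewrite expg0 oneE lenS | rewrite expgSr len_mul_tau].
Qed.

(** A reflection raises [len] by at most one and [tau] leaves it alone, so no word is shorter than
    [len]; following left descents down to a power of [tau] gives a word of exactly that size. *)
Lemma ellE x : ell x = len x.
Proof.
rewrite /ell; case: ex_minnP => n /asboolP[r [j [<- ->]]] min_r.
apply/eqP; rewrite eqn_leq; apply/andP; split; last first.
  have len_tauXr y m : len (y * tau ^+ m)%g = len y.
    by elim: m => [|m IHm]; rewrite ?mulg1 // expgSr mulgA len_mul_tau.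
  rewrite len_tauXr /word_prod; elim: (r) => [|i r' IHr].
    by rewrite big_nil (len_tauX 0).
  by rewrite big_cons; apply: leq_trans (len_srefl _ _) _.
apply: min_r; apply/asboolP.
move: (_ * _)%g => x'.
have [m] := ubnP (len x'); elim: m => // m IHm in x' *.
rewrite ltnS => le_x'm.
have [[i lt_ix]|[j' ->]] := len_descent x'; last first.
  by exists [::], j'; rewrite len_tauX /word_prod big_nil mul1g.
have -> : len x' = (len (srefl i * x')%g).+1.
  by apply/eqP; rewrite eqn_leq lt_ix andbT -{1}(sreflK i x') len_srefl.
have [r' [k [sz_r' Ek]]] := IHm _ (leq_trans lt_ix le_x'm).
exists (i :: r'), k; rewrite /= sz_r' /word_prod big_cons -mulgA; split => //.
by rewrite -[X in _ = (_ * X)%g]Ek sreflK.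
Qed.

(** * Reduction modulo commutators *)

Definition ceq (H : algType laurent) (x y : H) : Prop := commutators H (x - y).

Notation "x ≡ y" := (ceq x y) (at level 70, y at next level).

Lemma commutatorsD (H : algType laurent) (x y : H) :
  commutators H x -> commutators H y -> commutators H (x + y).
Proof. by move=> [r ->] [r' ->]; exists (r ++ r'); rewrite big_cat. Qed.

Lemma commutatorsZ (H : algType laurent) a (x : H) :
  commutators H x -> commutators H (a *: x).
Proof.
move=> [r ->]; exists [seq (a * p.1, p.2) | p <- r].
rewrite big_map scaler_sumr; apply: eq_bigr => p _ /=.
by rewrite scalerA.
Qed.

Lemma ceqC (H : algType laurent) (x y : H) : x * y ≡ y * x.
Proof. by exists [:: (1, (x, y))]; rewrite big_seq1 scale1r. Qed.

Lemma ceq_refl (H : algType laurent) (x : H) : x ≡ x.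
Proof. by exists [::]; rewrite big_nil subrr. Qed.

Lemma ceq_sym (H : algType laurent) (x y : H) : x ≡ y -> y ≡ x.
Proof. by move/(commutatorsZ (-1)); rewrite /ceq scaleN1r opprB. Qed.

Lemma ceq_trans (H : algType laurent) (y x z : H) : x ≡ y -> y ≡ z -> x ≡ z.
Proof. by move=> xy /(commutatorsD xy); rewrite /ceq addrA subrK. Qed.

Lemma ceqD (H : algType laurent) (x y x' y' : H) :
  x ≡ x' -> y ≡ y' -> x + y ≡ x' + y'.
Proof. by move=> xx' /(commutatorsD xx'); rewrite /ceq addrACA opprD. Qed.

Lemma ceqZ (H : algType laurent) a (x x' : H) : x ≡ x' -> a *: x ≡ a *: x'.
Proof. by move/(commutatorsZ a); rewrite /ceq scalerBr. Qed.

Lemma ceq_sum (H : algType laurent) (I : eqType) (r : seq I) (f g : I -> H) :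
  (forall i, i \in r -> f i ≡ g i) -> \sum_(i <- r) f i ≡ \sum_(i <- r) g i.
Proof.
elim: r => [|i r IHr] fg; first by rewrite !big_nil; exact: ceq_refl.
rewrite !big_cons; apply: ceqD; first exact/fg/mem_head.
by apply: IHr => j j_r; apply: fg; rewrite in_cons j_r orbT.
Qed.

Definition q : laurent := v - vinv.

Lemma ell_srefl i : ell (srefl i) = 1%N.
Proof.
by rewrite ellE; move: i; apply: ord3P; rewrite /srefl /= ?s0E ?s1E ?s2E !lenS.
Qed.

Lemma srefl_inv i : ((srefl i)^-1 = srefl i)%g.
Proof. by apply: (mulgI (srefl i)); rewrite mulgV -[X in (_ * X)%g]mulg1 sreflK. Qed.

Lemma hecke_sq (H : algType laurent) (T : extW -> H) i : is_hecke T ->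
  T (srefl i) * T (srefl i) = 1 + q *: T (srefl i).
Proof.
move=> [_ _ /(_ i)].
rewrite mulrDr !mulrBl mulr_algl !mulr_algr scalerA mulrC v_vinv scale1r.
move=> E; rewrite /q scalerBl; apply: subr0_eq; rewrite -[RHS]E -[RHS]addrA.
by congr (_ + _); rewrite opprD opprB addrCA [RHS]addrC -[RHS]addrA.
Qed.

Lemma hecke_srefll (H : algType laurent) (T : extW -> H) i x : is_hecke T ->
  len (srefl i * x)%g = (len x).+1 -> T (srefl i * x)%g = T (srefl i) * T x.
Proof. by move=> hT lx; rewrite (hecke_mul hT) // ell_srefl !ellE lx. Qed.

Lemma hecke_sreflr (H : algType laurent) (T : extW -> H) i x : is_hecke T ->
  len (x * srefl i)%g = (len x).+1 -> T (x * srefl i)%g = T x * T (srefl i).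
Proof. by move=> hT lx; rewrite (hecke_mul hT) // ell_srefl !ellE lx addn1. Qed.

(** With s the reflection, [T x] = T_s [T z] T_s; rotating the first factor to the end produces
    T_s^2, to which the quadratic relation applies. *)
Lemma ceq_descent (H : algType laurent) (T : extW -> H) i x y z : is_hecke T ->
  (srefl i * x = y)%g -> (y * srefl i = z)%g ->
  len x = (len y).+1 -> len y = (len z).+1 -> T x ≡ T z + q *: T y.
Proof.
move=> hT Ey Ez lx ly.
have Ex : x = (srefl i * y)%g by rewrite -Ey sreflK.
have {}Ey : y = (z * srefl i)%g.
  by apply: invg_inj; rewrite -Ez !invMg srefl_inv sreflK.
have Ty : T y = T z * T (srefl i) by rewrite {1}Ey hecke_sreflr // -Ey.
rewrite {1}Ex hecke_srefll -?Ex // Ty; apply: ceq_trans (ceqC _ _) _.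
rewrite -mulrA hecke_sq // mulrDr mulr1 -scalerAr; exact: ceq_refl.
Qed.

(** Both sides are products of T_s and [T y], in opposite orders, because y is shorter than x and
    z. *)
Lemma ceq_cyclic (H : algType laurent) (T : extW -> H) i x y z : is_hecke T ->
  (srefl i * x = y)%g -> (y * srefl i = z)%g ->
  len x = (len y).+1 -> len z = (len y).+1 -> T x ≡ T z.
Proof.
move=> hT Ey Ez lx lz.
have Ex : x = (srefl i * y)%g by rewrite -Ey sreflK.
rewrite {1}Ex -Ez hecke_srefll ?hecke_sreflr -?Ex ?Ez //; exact: ceqC.
Qed.

(** Since [tau] has length zero, T_tau and T_(tau^-1) multiply without any quadratic correction. *)
Lemma ceq_tau (H : algType laurent) (T : extW -> H) x : is_hecke T ->
  T (tau * x * tau^-1)%g ≡ T x.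
Proof.
move=> hT.
have len_tau y : ell (tau * y)%g = ell y.
  rewrite !ellE; move: y; apply: extW_ind => a b; apply: S3_ind;
  repeat progress extW_norm; rewrite !lenS; lia.
have ell_tau : ell tau = 0%N by rewrite ellE tau_E lenS.
have ell_tauV : ell tau^-1%g = 0%N.
  by rewrite -(len_tau tau^-1%g) mulgV ellE (len_tauX 0).
rewrite -(hecke_mul hT); last first.
  by rewrite ell_tauV addn0 [RHS]ellE -[RHS]len_mul_tau mulgKV -ellE.
apply: ceq_trans (ceqC _ _) _.
rewrite (hecke_mul hT) mulKg; first exact: ceq_refl.
by rewrite ell_tauV len_tau.
Qed.

Lemma ceq_tr (H : algType laurent) (T : extW -> H) w lam : is_hecke T ->
  T (tr (wact w lam)) ≡ T (tr lam).
Proof.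
move=> hT.
(* A cyclic shift needs a simple reflection that shortens the translation from the left, which
   requires a negative coordinate; the positive case is this one read backwards. *)
have neg1 (a b : int) : a < 0 -> T (tr (a, b)) ≡ T (tr (- a, a + b)).
  move=> a_lt0; apply: (@ceq_cyclic _ _ I3_1 _ (Ext (- a, a + b) p1) _ hT);
  rewrite /srefl /tr /=; [extW_solve | extW_solve | |]; rewrite !lenS; lia.
have neg2 (a b : int) : b < 0 -> T (tr (a, b)) ≡ T (tr (a + b, - b)).
  move=> a_lt0; apply: (@ceq_cyclic _ _ I3_2 _ (Ext (a + b, - b) p2) _ hT);
  rewrite /srefl /tr /=; [extW_solve | extW_solve | |]; rewrite !lenS; lia.
have T1 mu : T (tr (wact p1 mu)) ≡ T (tr mu).
  case: mu => a b; rewrite wactS; have [/neg1 Ta||->] := ltrgtP a 0.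
  - exact: ceq_sym.
  - move=> a_gt0; apply: ceq_trans (neg1 _ _ _) _; first by lia.
    by rewrite opprK addKr; exact: ceq_refl.
  - by rewrite oppr0 add0r; exact: ceq_refl.
have T2 mu : T (tr (wact p2 mu)) ≡ T (tr mu).
  case: mu => a b; rewrite wactS; have [/neg2 Tb||->] := ltrgtP b 0.
  - exact: ceq_sym.
  - move=> b_gt0; apply: ceq_trans (neg2 _ _ _) _; first by lia.
    by rewrite opprK addrK; exact: ceq_refl.
  - by rewrite oppr0 addr0; exact: ceq_refl.
move: w; apply: S3_ind => //; first by rewrite wact1; exact: ceq_refl.
- by rewrite wactM; apply: ceq_trans (T1 _) (T2 _).
- by rewrite wactM; apply: ceq_trans (T2 _) (T1 _).
- have <- : (p1 * p21 = p0)%g by rewrite perm3M.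
  rewrite wactM wactM; apply: ceq_trans (T1 _) _.
  exact: ceq_trans (T2 _) (T1 _).
Qed.

(** Conjugation by [tau] cycles the reflections [p1], [p2], [p0]; together with [ceq_tau_p0] this
    gives every element with odd linear part a normal form with linear part [p1]. *)
Lemma ceq_tau_p2 (H : algType laurent) (T : extW -> H) (a b : int) : is_hecke T ->
  T (Ext (- a - b, a) p2) ≡ T (Ext (a, b) p1).
Proof.
move=> hT.
rewrite (_ : Ext _ p2 = tau * Ext (a, b) p1 * tau^-1)%g; first exact: ceq_tau.
extW_solve.
Qed.

Lemma ceq_tau_p0 (H : algType laurent) (T : extW -> H) (a b : int) : is_hecke T ->
  T (Ext (b + 1, 1 - a - b) p0) ≡ T (Ext (a, b) p1).
Proof.
move=> hT; apply: ceq_trans (ceq_tau_p2 _ _ hT).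
rewrite (_ : Ext _ p0 = tau * Ext (- a - b, a) p2 * tau^-1)%g; first exact: ceq_tau.
extW_solve.
Qed.

(** Conjugation by [s0] keeps the length 2a + 2b - 1; the next one, by [s2], lowers it by two
    because 2 < a. The term split off is a translation in the W-orbit of (a - 2, b + 1). *)
Lemma ceq_slide (H : algType laurent) (T : extW -> H) (a b : int) : is_hecke T ->
  2 < a -> 0 <= b ->
  T (Ext (a, b) p1) ≡ T (Ext (a - 2, b + 1) p1) + q *: T (tr (a - 2, b + 1)).
Proof.
move=> hT a_gt2 b_ge0.
apply: (@ceq_trans _ (T (Ext (- 1 - b, 2 - a) p2))).
  apply: (@ceq_cyclic _ _ I3_0 _ (Ext (1 - b, 1 - a) p12) _ hT);
  rewrite /srefl /=; [extW_solve | extW_solve | |]; rewrite !lenS; lia.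
set y := Ext (1 - a - b, a - 2) 1%g.
apply: (@ceq_trans _ (T (Ext (1 - a - b, a - 2) p2) + q *: T y)).
  apply: (@ceq_descent _ _ I3_2 _ _ _ hT);
  rewrite /srefl /y /=; [extW_solve | extW_solve | |]; rewrite !lenS; lia.
apply: ceqD.
  rewrite (_ : 1 - a - b = - (a - 2) - (b + 1)); last by ring.
  exact: ceq_tau_p2.
apply: ceqZ; rewrite /y -/(tr _).
rewrite (_ : (1 - a - b, a - 2) = wact p12 (a - 2, b + 1)); first exact: ceq_tr.
by rewrite wactS; congr pair; ring.
Qed.

(* The case b = 0 is a genuine exception: the lengths are then 3 and 1. *)
Lemma ceq_flip (H : algType laurent) (T : extW -> H) (b : int) : is_hecke T ->
  b != 0 -> T (Ext (2, b - 1) p1) ≡ T (Ext (0, b) p1).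
Proof.
move=> hT b_neq0; apply: ceq_trans (ceq_tau_p2 _ _ hT).
(* Left multiplication by [s0] shortens the [p2] element when b < 0 and the [p1] element when b >
   0. *)
rewrite oppr0 add0r; have [b_lt0|b_gt0|] := ltrgtP b 0; last by lia.
  apply: ceq_sym; apply: (@ceq_cyclic _ _ I3_0 _ (Ext (1, b + 1) p21) _ hT);
  rewrite /srefl /=; [extW_solve | extW_solve | |]; rewrite !lenS; lia.
apply: (@ceq_cyclic _ _ I3_0 _ (Ext (2 - b, -1) p12) _ hT);
rewrite /srefl /=; [extW_solve | extW_solve | |]; rewrite !lenS; lia.
Qed.

(** The last of the n slides starts at first coordinate a - 2(n - 1), which exceeds 2 precisely when
    2n < a. *)
Lemma ceq_strip (H : algType laurent) (T : extW -> H) (a b : int) (n : nat) :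
  is_hecke T ->
  2 * n%:Z < a -> 0 <= b ->
  T (Ext (a, b) p1) ≡ T (Ext (a - 2 * n%:Z, b + n%:Z) p1)
    + q *: \sum_(1 <= i < n.+1) T (tr (a - 2 * i%:Z, b + i%:Z)).
Proof.
move=> hT + b_ge0; elim: n => [|n IHn] lt_n_a.
  by rewrite big_nil scaler0 mulr0 subr0 !addr0; exact: ceq_refl.
apply: ceq_trans (IHn _) _; first by lia.
rewrite [in X in _ ≡ X]big_nat_recr //= scalerDr addrCA addrC.
apply: ceqD; last exact: ceq_refl.
rewrite (_ : a - 2 * n.+1%:Z = a - 2 * n%:Z - 2); last by lia.
rewrite (_ : b + n.+1%:Z = b + n%:Z + 1); last by lia.
apply: ceq_slide => //; lia.
Qed.

Definition wk (k : int) : extW := Ext (3 * k - 1, 1) p21.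

(** A conjugation by [s0] of constant length, then descents along [s2] and [s0]. For k = 1 the
    leading term is already [tau]. *)
Lemma ceq_wk (H : algType laurent) (T : extW -> H) (k : int) : is_hecke T -> 0 < k ->
  T (wk k) ≡ T (Ext (4 - 3 * k, 3 * k - 3) p12)
    + q *: (T (Ext (3 * k - 2, 0) p1) + T (Ext (0, 2 - 3 * k) p1)).
Proof.
move=> hT k_gt0.
apply: (@ceq_trans _ (T (Ext (2, 1 - 3 * k) p12))).
  apply: (@ceq_cyclic _ _ I3_0 _ (Ext (0, 2 - 3 * k) p2) _ hT);
  rewrite /srefl /=; [extW_solve | extW_solve | |]; rewrite !lenS; lia.
apply: (@ceq_trans _ (T (Ext (3 - 3 * k, 3 * k - 1) p21)
                      + q *: T (Ext (3 - 3 * k, 3 * k - 1) p0))).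
  apply: (@ceq_descent _ _ I3_2 _ _ _ hT);
  rewrite /srefl /=; [extW_solve | extW_solve | |]; rewrite !lenS; lia.
rewrite scalerDr addrA; apply: ceqD; last first.
  apply: ceqZ; rewrite (_ : Ext _ _ = Ext (2 - 3 * k + 1, 1 - 0 - (2 - 3 * k)) p0).
    exact: ceq_tau_p0.
  extW_solve.
apply: (@ceq_trans _ (T (Ext (4 - 3 * k, 3 * k - 3) p12)
                      + q *: T (Ext (2 - 3 * k, 3 * k - 2) p2))).
  apply: (@ceq_descent _ _ I3_0 _ _ _ hT);
  rewrite /srefl /=; [extW_solve | extW_solve | |]; rewrite !lenS; lia.
apply: ceqD; first exact: ceq_refl.
apply: ceqZ; rewrite (_ : Ext _ _ = Ext (- (3 * k - 2) - 0, 3 * k - 2) p2).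
  exact: ceq_tau_p2.
extW_solve.
Qed.

(** The third descent, along [s1], starts from length 6k - 6, so it exists only for k > 1. *)
Lemma ceq_wk_step (H : algType laurent) (T : extW -> H) (k : int) :
  is_hecke T -> 1 < k ->
  T (Ext (4 - 3 * k, 3 * k - 3) p12) ≡ T (wk (k - 1))
    + q *: T (Ext (1, 3 - 3 * k) p1).
Proof.
move=> hT k_gt1.
apply: (@ceq_trans _ (T (wk (k - 1)) + q *: T (Ext (3 * k - 4, 1) p2))).
  apply: (@ceq_descent _ _ I3_1 _ _ _ hT);
  rewrite /srefl /wk /=; [extW_solve | extW_solve | |]; rewrite !lenS; lia.
apply: ceqD; first exact: ceq_refl.
apply: ceqZ; rewrite (_ : Ext _ _ = Ext (- 1 - (3 - 3 * k), 1) p2).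
  exact: ceq_tau_p2.
extW_solve.
Qed.

(** * Conjugacy classes *)

(** For each reflection, the class is cut out by the linear function of the translation part that
    vanishes on the root of that reflection. *)
Lemma O_int_tauP i x : O_int_tau i x <-> exists a b : int,
  [\/ x = Ext (a, b) p1 /\ a + 2 * b = 3 * i - 2,
      x = Ext (a, b) p2 /\ 2 * a + b = 2 - 3 * i |
      x = Ext (a, b) p0 /\ a - b = 3 * i - 2].
Proof.
split=> [[k [] ->]|[a [b [] [-> E]]]].
- exists (2 * k - i), (2 * i - k - 1); constructor 1; split; [extW_solve | lia].
- exists (k + 2 * i - 1), (k - i + 1); constructor 3; split; [extW_solve | lia].
- exists (1 - 2 * i - k), (2 * k + i); constructor 2; split; [extW_solve | lia].
- exists (2 * i - b - 1); constructor 1; extW_solve.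
- exists (1 - 2 * i - a); constructor 3; extW_solve.
- exists (b + i - 1); constructor 2; extW_solve.
Qed.

Lemma O_int_tauE i : O_int_tau i = conj_class (Ext (3 * i - 2, 0) p1).
Proof.
apply/seteqP; split=> x; last first.
  case; apply: extW_ind => c d w _ <-; apply/O_int_tauP.
  move: w; apply: S3_ind; repeat progress extW_norm; do 2 eexists;
  first [constructor 1; split; [reflexivity | rewrite /=; lia]
        |constructor 2; split; [reflexivity | rewrite /=; lia]
        |constructor 3; split; [reflexivity | rewrite /=; lia]].
move/O_int_tauP=> [a [b [] [-> E]]].
(* A translation by mu moves the translation part by [mu.1] times [alpha1]; [tau] and its square
   then reach the other two reflections. *)
- exists (Ext (- b, 0) 1%g) => //; extW_solve.
- exists (tau * Ext (a + b, 0) 1)%g => //; extW_solve.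
- exists (tau * tau * Ext (1 - a, 0) 1)%g => //; extW_solve.
Qed.

(** The equation says that a + 2b is 1 modulo 3, that is, (a, b) lies in the coset omega1 + Q. *)
Lemma O_id_tauP x : O_id_tau x <-> exists a b n : int, a = 3 * n - 2 * b + 1 /\
  (x = Ext (a, b) p12 \/ x = Ext (a, b) p21).
Proof.
split=> [[m [n [] ->]]|[a [b [n [E [] ->]]]]].
- exists (2 * m - n + 1), (2 * n - m), n; split; [lia | left; extW_solve].
- exists (2 * m - n - 1), (2 * n - m + 1), n; split; [lia | right; extW_solve].
- exists (2 * n - b), n; left; extW_solve.
- exists (2 * n + 1 - b), n; right; extW_solve.
Qed.

(** The image of 1 - s1 s2 on P is Q, so translations conjugate [tau] to every t^(omega1 + Q) s1 s2;
    a reflection turns [p12] into [p21]. *)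
Lemma O_id_tauE : O_id_tau = conj_class tau.
Proof.
apply/seteqP; split=> x; last first.
  case; apply: extW_ind => c d w _ <-; apply/O_id_tauP.
  move: w; apply: S3_ind; repeat progress extW_norm; do 2 eexists;
  [exists d | exists (c + d) | exists (c + d) | exists d | exists (d - 1)
  | exists (c + d - 1)]; (split; last by [left | right]); rewrite /=; lia.
move/O_id_tauP=> [a [b [n [E [] ->]]]].
- exists (Ext (n - b, n) 1%g) => //; extW_solve.
- exists (Ext (a + b - n, b - n - 1) p1) => //; extW_solve.
Qed.

Definition omega2 : coweight := (0, 1).

(** As s2 s1 tau is the translation by - omega2, only the linear part of a conjugator acts, and the
    class is a W-orbit of translations. *)
Lemma O_lam_tauP (lam : coweight) x : O_lam_tau lam x <->
  exists w, x = tr (wact w (lam - omega2)).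
Proof.
have E y : (y * (tr lam * s2 * s1 * tau) * y^-1)%g
    = tr (wact (ext_lin y) (lam - omega2)).
  move: y; apply: extW_ind => c d w; case: lam => a b.
  rewrite (_ : (tr (a, b) * s2 * s1 * tau)%g = tr ((a, b) - omega2)%R)%g; last first.
    rewrite /tr; extW_solve.
  rewrite /tr extW_invE !extW_mulE /= mulg1 mulgV wactN -wactM mulgV wact1.
  by rewrite addrAC subrr add0r.
split=> [[y _ <-]|[w ->]]; first by exists (ext_lin y); rewrite E.
by exists (Ext 0 w) => //; rewrite E.
Qed.

Lemma wact_dominant_inj (a b c d : int) w : 0 <= a -> 0 <= b -> 0 <= c -> 0 <= d ->
  wact w (a, b) = (c, d) -> (a, b) = (c, d).
Proof.
move=> a0 b0 c0 d0; move: w; apply: S3_ind; rewrite wactS => -[Ec Ed];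
congr pair; lia.
Qed.

Lemma O_int_tau_inj : injective O_int_tau.
Proof.
move=> i j Eij; have : O_int_tau i (Ext (3 * i - 2, 0) p1).
  by apply/O_int_tauP; exists (3 * i - 2), 0; constructor 1; split; [|lia].
rewrite Eij => /O_int_tauP [a [b [] [[Ea Eb]]]]; first lia.
- by move/(congr1 (fun w : 'S_3 => val (w I3_0))); rewrite !permE.
- by move/(congr1 (fun w : 'S_3 => val (w I3_0))); rewrite !permE.
Qed.

(** Linear parts separate the three families: reflections here, the identity for [O_lam_tau],
    rotations of order three for [O_id_tau]. *)
Lemma odd_O_int_tau i x : O_int_tau i x -> odd_perm (ext_lin x).
Proof. by move/O_int_tauP => [a [b [] [-> _]]]; rewrite odd_tperm. Qed.

Lemma even_O_id_tau x : O_id_tau x -> odd_perm (ext_lin x) = false.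
Proof. by move/O_id_tauP => [a [b [n [_ [] ->]]]]; rewrite odd_permM !odd_tperm. Qed.

Lemma lin_O_lam_tau lam x : O_lam_tau lam x -> ext_lin x = 1%g.
Proof. by move/O_lam_tauP => [w ->]. Qed.

Lemma conj_class_self x : conj_class x x.
Proof. by exists 1%g => //; rewrite mul1g invg1 mulg1. Qed.

Lemma O_lam_neq_int lam i : O_lam_tau lam <> O_int_tau i.
Proof.
move=> E; have Ox : O_lam_tau lam (tr lam * s2 * s1 * tau)%g.
  exact: conj_class_self.
have Ex := lin_O_lam_tau Ox; move: Ox; rewrite E => /odd_O_int_tau.
by rewrite Ex odd_perm1.
Qed.

Lemma O_lam_neq_id lam : O_lam_tau lam <> O_id_tau.
Proof.
move=> E; have : O_id_tau tau by rewrite O_id_tauE; exact: conj_class_self.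
rewrite -E => /lin_O_lam_tau /(congr1 (fun w : 'S_3 => val (w I3_0))).
by rewrite tauE permM !permE.
Qed.

Lemma O_int_neq_id i : O_int_tau i <> O_id_tau.
Proof.
move=> E; have : O_id_tau tau by rewrite O_id_tauE; exact: conj_class_self.
move=> Otau; have := even_O_id_tau Otau.
by rewrite -E in Otau; rewrite (odd_O_int_tau Otau).
Qed.

(** A minimal element has length zero like [tau]; the [p21] candidate would be tau^2, whose a + 2b
    is 2 modulo 3. *)
Lemma min_rep_id (m : set extW -> extW) : min_reps m -> m O_id_tau = tau.
Proof.
move=> /(_ O_id_tau) [|Om min_m]; first by exists tau; rewrite ?O_id_tauE.
have Otau : O_id_tau tau by rewrite O_id_tauE; exact: conj_class_self.
have := min_m _ Otau; move/O_id_tauP: Om => [a [b [n [E [] ->]]]];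
rewrite !ellE tau_E !lenS => len0; last lia.
congr (Ext (_, _) _); lia.
Qed.

Lemma ceq_min_rep_lam (H : algType laurent) (T : extW -> H) m lam : is_hecke T ->
  min_reps m -> T (tr (lam - omega2)) ≡ T (m (O_lam_tau lam)).
Proof.
move=> hT /(_ (O_lam_tau lam)) [|/O_lam_tauP[w ->] _]; first by eexists.
exact/ceq_sym/ceq_tr.
Qed.

(** On the line a + 2b = n the length is |a - 1| + max(|n|, |a|). For n nonzero it is least at a = 1
    if n is odd, and at both a = 0 and a = 2 if n is even; [ceq_flip] joins the latter two. *)
Lemma ceq_p1_min (H : algType laurent) (T : extW -> H) (a b c d : int) : is_hecke T ->
  a + 2 * b = c + 2 * d -> a + 2 * b != 0 -> 0 <= a <= 2 ->
  (len (Ext (c, d) p1) <= len (Ext (a, b) p1))%N ->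
  T (Ext (a, b) p1) ≡ T (Ext (c, d) p1).
Proof.
move=> hT E n_neq0 le_a; rewrite !lenS => le_len.
have : [\/ c = a /\ d = b, [/\ a = 2, c = 0 & d = b + 1]
         | [/\ a = 0, c = 2 & d = b - 1]].
  have : [|| (c == a) && (d == b), [&& a == 2, c == 0 & d == b + 1]
         | [&& a == 0, c == 2 & d == b - 1]] by lia.
  case/or3P.
  - by case/andP=> /eqP-> /eqP->; constructor 1.
  - by case/and3P=> /eqP-> /eqP-> /eqP->; constructor 2.
  - by case/and3P=> /eqP-> /eqP-> /eqP->; constructor 3.
case=> [[-> ->]|[Ea -> ->]|[Ea -> ->]]; first exact: ceq_refl.
- rewrite Ea -{1}(addrK 1 b); apply: ceq_flip => //; lia.
- rewrite Ea; apply/ceq_sym/ceq_flip => //; lia.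
Qed.

(** Conjugation by [tau] preserves length, so a representative with linear part [p2] or [p0] is
    compared in its [p1] form; 3i - 2 is never 0, which avoids the exception of [ceq_flip]. *)
Lemma ceq_min_rep_int (H : algType laurent) (T : extW -> H) m i (a b : int) :
  is_hecke T -> min_reps m -> 0 <= a <= 2 -> a + 2 * b = 3 * i - 2 ->
  T (Ext (a, b) p1) ≡ T (m (O_int_tau i)).
Proof.
move=> hT hm le_a Eab; have [|Om min_m] := hm (O_int_tau i).
  by exists (Ext (3 * i - 2, 0) p1); rewrite ?O_int_tauE.
have /min_m : O_int_tau i (Ext (a, b) p1).
  by apply/O_int_tauP; exists a, b; constructor 1.
rewrite !ellE; move/O_int_tauP: Om => [c [d [] [-> E]]] le_len.
- apply: ceq_p1_min => //; lia.
- have -> : c = - d - (- c - d) by ring.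
  apply: ceq_trans (ceq_sym (ceq_tau_p2 _ _ hT)).
  apply: ceq_p1_min => //; first lia; first lia.
  by move: le_len; rewrite !lenS; lia.
- have -> : c = (c - 1) + 1 by ring.
  have -> : d = 1 - (2 - c - d) - (c - 1) by ring.
  apply: ceq_trans (ceq_sym (ceq_tau_p0 _ _ hT)).
  apply: ceq_p1_min => //; first lia; first lia.
  by move: le_len; rewrite !lenS; lia.
Qed.

(** * The expansion of [T_w] *)

(* For k = 1 the class O_{3-2k} = O_k is split off only once. *)
Fixpoint int_idx (k : nat) : seq int :=
  if k is k'.+1 then
    k%:Z :: 2 - 2 * k%:Z :: (if k' is 0 then [::] else 3 - 2 * k%:Z :: int_idx k')
  else [::].

Lemma int_idxS k : int_idx k.+2 =
  [:: k.+2%:Z, 2 - 2 * k.+2%:Z, 3 - 2 * k.+2%:Z & int_idx k.+1].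
Proof. by []. Qed.

(** From k >= 1 to k + 1 the interval grows by one integer at the top and two at the bottom, the
    three new heads of the list. *)
Lemma mem_int_idx k i : (i \in int_idx k) = ((0 < k)%N && (2 - 2 * k%:Z <= i <= k%:Z)).
Proof.
elim: k => [|[|k] IHk] //; first by rewrite /= !inE; lia.
by rewrite int_idxS 3!in_cons IHk; lia.
Qed.

Lemma uniq_int_idx k : uniq (int_idx k).
Proof.
elim: k => [|[|k] IHk] //.
rewrite int_idxS; move: (int_idx k.+1) (mem_int_idx k.+1) IHk => s mem_s uniq_s.
rewrite !cons_uniq uniq_s !in_cons !mem_s; lia.
Qed.

Definition Qlat (m n : int) : coweight := alpha1 *~ m + alpha2 *~ n.

Lemma QlatE m n : Qlat m n = (2 * m - n, 2 * n - m).
Proof.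
rewrite /Qlat /alpha1 /alpha2 !coweight_mulz coweightD; congr pair; lia.
Qed.

Lemma Qlat_inj m n m' n' : Qlat m n = Qlat m' n' -> m = m' /\ n = n'.
Proof. rewrite !QlatE => -[]; lia. Qed.

(** Entry i comes from the i-th slide of t^(3k - 2, 0) s1; (3k - 3)/2 rounded down is the largest n
    with 2n < 3k - 2. The list is empty for k <= 1. *)
Definition E_idx (k : nat) : seq coweight :=
  [seq Qlat (2 * k%:Z - 1 - i%:Z) k%:Z | i <- index_iota 1 ((3 * k - 3)./2).+1].

Lemma E_idxP k lam : (lam \in E_idx k) <-> (0 < k)%N /\ E_tau (2 * k%:Z - 1) k%:Z lam.
Proof.
rewrite /E_tau /=; split=> [/mapP[i]|[k_gt0 [n [le_n n_le ->]]]].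
  rewrite mem_index_iota => i_le ->; split; first lia.
  by exists (2 * k%:Z - 1 - i%:Z); split => //; lia.
apply/mapP; exists `|(2 * k%:Z - 1 - n)%R|%N; first by rewrite mem_index_iota; lia.
by congr Qlat; lia.
Qed.

Lemma uniq_E_idx k : uniq (E_idx k).
Proof.
rewrite map_inj_in_uniq ?iota_uniq // => i j _ _ /Qlat_inj; lia.
Qed.

Fixpoint lam_idx (k : nat) : seq coweight :=
  if k is k'.+1 then E_idx k ++ lam_idx k' else [::].

(** The union may start at j = 2 since E_(alpha1 + alpha2) is empty. *)
Lemma lam_idxP k lam : (lam \in lam_idx k) <->
  exists2 j : int, 2 <= j <= k%:Z & E_tau (2 * j - 1) j lam.
Proof.
elim: k => [|k IHk] /=; first by split => // -[j]; lia.
rewrite mem_cat; split=> [/orP[/E_idxP[_ Elam]|/IHk[j lt_j Ej]]|[j le_j Ej]].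
- by exists k.+1%:Z => //; move: Elam => [n [? ? _]]; lia.
- by exists j => //; lia.
- have [Ejk|ne_jk] := eqVneq j k.+1%:Z.
    by apply/orP; left; apply/E_idxP; rewrite -Ejk.
  by apply/orP; right; apply/IHk; exists j => //; lia.
Qed.

Lemma uniq_lam_idx k : uniq (lam_idx k).
Proof.
elim: k => [|k IHk] //=; rewrite cat_uniq uniq_E_idx IHk andbT /=.
apply/hasPn => lam /lam_idxP[j le_j [n [_ _ Elam]]]; apply/negP.
move=> /E_idxP[_ [n' [_ _ ]]]; rewrite Elam => /Qlat_inj; lia.
Qed.

Lemma lam_idx_dominant k lam : lam \in lam_idx k ->
  0 <= (lam - omega2).1 /\ 0 <= (lam - omega2).2.
Proof.
move=> /lam_idxP[j le_j [n [le_n n_le ->]]]; rewrite -/(Qlat _ _) QlatE /=; lia.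
Qed.

(** Equal classes put two dominant coweights lam - omega2 and mu - omega2 in one W-orbit, which
    meets the dominant chamber once. *)
Lemma O_lam_tau_inj k : {in lam_idx k &, injective O_lam_tau}.
Proof.
move=> lam mu /lam_idx_dominant + /lam_idx_dominant + E.
have /O_lam_tauP[w] : O_lam_tau mu (tr (lam - omega2)).
  by rewrite -E; apply/O_lam_tauP; exists 1%g; rewrite wact1.
move=> /(congr1 ext_trans) Elm lam_ge0 mu_ge0.
have {}Elm : lam - omega2 = wact w (mu - omega2) := Elm.
apply: (can_inj (subrK omega2)); move: Elm lam_ge0 mu_ge0.
case: (lam - omega2) (mu - omega2) => [a b] [c d] /= Elm [a0 b0] [c0 d0].
by symmetry; apply: (@wact_dominant_inj _ _ _ _ w) => //.
Qed.

Lemma ceq_wk_expansion (H : algType laurent) (T : extW -> H) m k : is_hecke T ->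
  min_reps m ->
  T (wk k.+1%:Z) ≡ T tau + q *: \sum_(i <- int_idx k.+1) T (m (O_int_tau i))
    + q ^+ 2 *: \sum_(lam <- lam_idx k.+1) T (m (O_lam_tau lam)).
Proof.
move=> hT hm.
(* The maximal number of slides leaves first coordinate 1 or 2, where the length is minimal in the
   class. *)
have strip n : T (Ext (3 * n.+1%:Z - 2, 0) p1) ≡ T (m (O_int_tau n.+1%:Z))
    + q *: \sum_(lam <- E_idx n.+1) T (m (O_lam_tau lam)).
  have lt_a : 2 * ((3 * n.+1 - 3)./2)%:Z < 3 * n.+1%:Z - 2 by lia.
  apply: ceq_trans (ceq_strip hT lt_a (lexx 0)) _.
  apply: ceqD; first by apply: (ceq_min_rep_int hT hm); lia.
  apply: ceqZ; rewrite big_map; apply: ceq_sum => i _.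
  apply: ceq_trans _ (ceq_min_rep_lam _ hT hm).
  rewrite (_ : (_, _) = Qlat (2 * n.+1%:Z - 1 - i%:Z) n.+1%:Z - omega2).
    exact: ceq_refl.
  rewrite QlatE /omega2 coweightN coweightD; congr pair; lia.
(* X and Y collect what the later reductions split off; the sum over [E_idx] carries q^2, one q from
   the descent and one from the slide. *)
have rest n (X Y : H) :
    T (Ext (4 - 3 * n.+1%:Z, 3 * n.+1%:Z - 3) p12) ≡ T tau + q *: X + q ^+ 2 *: Y ->
  T (wk n.+1%:Z) ≡ T tau + q *: (T (m (O_int_tau n.+1%:Z))
      + (T (m (O_int_tau (2 - 2 * n.+1%:Z))) + X))
    + q ^+ 2 *: (\sum_(lam <- E_idx n.+1) T (m (O_lam_tau lam)) + Y).
  move=> rest; apply: ceq_trans (ceq_wk hT _) _; first lia.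
  have last_class : T (Ext (0, 2 - 3 * n.+1%:Z) p1)
      ≡ T (m (O_int_tau (2 - 2 * n.+1%:Z))).
    by apply: (ceq_min_rep_int hT hm); lia.
  apply: ceq_trans (ceqD rest (ceqZ _ (ceqD (strip n) last_class))) _.
  rewrite !scalerDr scalerA -expr2.
  rewrite [X in X ≡ _](+%R.[AC (3*3) ((1*(4*(6*2)))*(5*3))]).
  exact: ceq_refl.
elim: k => [|k IHk].
  (* For k = 1 the element left over is [tau], so nothing further splits off. *)
  apply: ceq_trans (rest 0%N 0 0 _) _.
    by rewrite !scaler0 !addr0 tau_E; exact: ceq_refl.
  rewrite (_ : lam_idx 1 = E_idx 1) // (addr0 (\sum_(_ <- _) _)) !big_cons !big_nil.
  exact: ceq_refl.
rewrite int_idxS 3!big_cons big_cat.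
apply: rest; apply: ceq_trans (ceq_wk_step hT _) _; first lia.
have second_class : T (Ext (1, 3 - 3 * k.+2%:Z) p1)
    ≡ T (m (O_int_tau (3 - 2 * k.+2%:Z))).
  by apply: (ceq_min_rep_int hT hm); lia.
rewrite (_ : k.+2%:Z - 1 = k.+1%:Z); last lia.
apply: ceq_trans (ceqD IHk (ceqZ _ second_class)) _.
rewrite addrAC -(addrA (T tau)) -scalerDr (addrC _ (T (m (O_int_tau _)))).
exact: ceq_refl.
Qed.

Lemma fsum_seq (V : lmodType laurent) (I : choiceType) (D : set I) (e : I -> V)
    (c : I -> laurent) (r : seq I) :
  uniq r -> [set` r] `<=` D -> (forall i, D i -> i \notin r -> c i = 0) ->
  \sum_(i \in D) c i *: e i = \sum_(i <- r) c i *: e i.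
Proof.
move=> r_uniq rD c0; rewrite (fsbigE r) //; last first.
  by move=> i Di /(c0 i Di) ->; rewrite scale0r.
rewrite big_seq_cond [RHS]big_seq_cond; apply: eq_bigl => i.
by rewrite andbT; case: (boolP (i \in r)) => //= /rD/mem_set ->.
Qed.

Lemma conj_classes_int i : conj_classes (O_int_tau i).
Proof. by exists (Ext (3 * i - 2, 0) p1); rewrite ?O_int_tauE. Qed.

Lemma conj_classes_id : conj_classes O_id_tau.
Proof. by exists tau; rewrite ?O_id_tauE. Qed.

(** Coefficients are compared relative to a choice of representatives, so uniqueness needs at least
    one choice. *)
Lemma min_reps_exist : exists m, min_reps m.
Proof.
have ex_min O : exists x, conj_classes O -> min_length O x.
  have [[x _ <-]|] := EM (conj_classes O); last by exists 1%g.
  have ex_n : exists n, `[< exists2 y, conj_class x y & ell y = n >].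
    by exists (ell x); apply/asboolP; exists x => //; exact: conj_class_self.
  case: (ex_minnP ex_n) => n /asboolP[y Oy <-] min_y; exists y => _; split=> // z Oz.
  by apply: min_y; apply/asboolP; exists z.
exists (fun O => sval (cid (ex_min O))) => O; exact: svalP (cid (ex_min O)).
Qed.

Unset Implicit Arguments.

Theorem proposition2p28 (H : algType laurent) (T : extW -> H)
    (hT : is_hecke T) (k : nat) (hk : (0 < k)%N) :
  let w : extW := (tQ (2 * k%:Z) k%:Z * s1 * s2 * tau)%g in
  let c (O : set extW) : laurent :=
    if `[< exists2 lam : coweight,
             (\bigcup_(j in [set j : int | 2 <= j <= k%:Z])
                E_tau (2 * j - 1) j) lam &
             O = O_lam_tau lam >] then (v - vinv) ^+ 2
    else if `[< exists2 i : int, 2 - 2 * k%:Z <= i <= k%:Z &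
                  O = O_int_tau i >] then v - vinv
    else if `[< O = O_id_tau >] then 1
    else 0 in
  class_polynomials T w c /\
  (he_nie T -> forall f : set extW -> laurent, class_polynomials T w f ->
     forall O : set extW, conj_classes O -> f O = c O).
Proof.
move=> w c.
(* The basis property of He and Nie turns the existence of this expansion into uniqueness of the
   coefficients. *)
suff cw : class_polynomials T w c.
  split=> // -[_ basis] f fw O Oconj; have [m hm] := min_reps_exist.
  exact: (basis m hm).2 (T w) f c (fw m hm) (cw m hm) O Oconj.
move=> m hm.
pose r := O_id_tau :: [seq O_int_tau i | i <- int_idx k]
                   ++ [seq O_lam_tau lam | lam <- lam_idx k].
have mem_lam lam : (lam \in lam_idx k) <->
    (\bigcup_(j in [set j : int | 2 <= j <= k%:Z]) E_tau (2 * j - 1) j) lam.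
  exact: lam_idxP.
have mem_int i : (i \in int_idx k) = (2 - 2 * k%:Z <= i <= k%:Z).
  by rewrite mem_int_idx hk.
have c_lam lam : lam \in lam_idx k -> c (O_lam_tau lam) = q ^+ 2.
  by move=> /mem_lam lam_k; rewrite /c asboolT //; exists lam.
have c_int i : i \in int_idx k -> c (O_int_tau i) = q.
  rewrite mem_int => i_k; rewrite /c asboolF; last first.
    by move=> [lam _ /esym/O_lam_neq_int].
  by rewrite asboolT //; exists i.
have c_id : c O_id_tau = 1.
  rewrite /c asboolF; last by move=> [lam _ /esym/O_lam_neq_id].
  by rewrite asboolF ?asboolT // => -[i _ /esym/O_int_neq_id].
have c_out O : O \notin r -> c O = 0.
  rewrite in_cons mem_cat => /norP[O_id /norP[O_int O_lam]].
  rewrite /c !asboolF // => [OE|[i i_k Oi]|[lam /mem_lam lam_k Olam]].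
  - by rewrite OE eqxx in O_id.
  - by move/negP: O_int; apply; rewrite Oi map_f ?mem_int.
  - by move/negP: O_lam; apply; rewrite Olam map_f.
(* The classes must be pairwise distinct for the sum over classes to match the sum over indices. *)
have r_uniq : uniq r.
  have uniq_int : uniq [seq O_int_tau i | i <- int_idx k].
    by rewrite (map_inj_uniq O_int_tau_inj) uniq_int_idx.
  have uniq_lam : uniq [seq O_lam_tau lam | lam <- lam_idx k].
    by rewrite (map_inj_in_uniq (@O_lam_tau_inj k)) uniq_lam_idx.
  rewrite /= cat_uniq uniq_int uniq_lam mem_cat andbT; apply/andP; split.
    apply/norP; split; apply/negP.
      by move=> /mapP[i _ /esym/O_int_neq_id].
    by move=> /mapP[lam _ /esym/O_lam_neq_id].
  by apply/hasPn => O /mapP[lam _ ->]; apply/negP => /mapP[i _ /O_lam_neq_int].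
have r_conj : [set` r] `<=` conj_classes.
  move=> O /=; rewrite in_cons mem_cat => /or3P[/eqP->|/mapP[i _ ->]|/mapP[lam _ ->]].
  - exact: conj_classes_id.
  - exact: conj_classes_int.
  - by eexists.
split.
  apply: (@sub_finite_set _ _ [set` r]); last exact: finite_seq.
  by move=> O [_ /= /eqP cO]; apply: contrapT => /negP /c_out.
rewrite (fsum_seq _ r_uniq r_conj) => [|O _ /c_out //].
have -> : w = wk k%:Z by rewrite /w /wk; extW_solve.
rewrite big_cons big_cat !big_map /= c_id scale1r min_rep_id // addrA.
rewrite (eq_big_seq (fun i => q *: T (m (O_int_tau i)))); last by move=> i /c_int ->.
rewrite [X in _ - (_ + X)](eq_big_seq (fun lam => q ^+ 2 *: T (m (O_lam_tau lam))));
  last by move=> lam /c_lam ->.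
rewrite -!scaler_sumr; case: (k) hk => // k' _; exact: (ceq_wk_expansion k' hT hm).
Qed.
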